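(* Let $V,W$ be finite-dimensional vector spaces, $u$ a positive integer with $u\le\min(\dim V,\dim W)$, and $k$ an integer with $1\le k\le u-1$. Then the blow-up locus $Z_k^-\subset Y_{k-\frac12}$ is the proper transform of $\mathrm{Sec}_k(S_V,W)\subset Y_{\frac12}=\mathbb P\,\mathrm{Hom}(S_V,W)$.
   Context: The base field is $\mathbb C$ (or any algebraically closed field of characteristic $0$). For a vector space $E$, $\mathrm{Gr}_iE$ is the Grassmannian of $i$-dimensional subspaces of $E$, with tautological subbundle $S_E$ and tautological quotient bundle $Q_E$; $\mathbb P$ denotes the space (bundle) of lines. $Y=\mathrm{Gr}_u(V\oplus W)$, with the action of $T=\mathbb C^\times$ induced by $\lambda(v,w)=(\lambda v,\lambda^{-1}w)$. $L$ is the ample line bundle $\det Q_{V\oplus W}$ on $Y$ with its canonical linearization of the $T$-action; for $t\in\chi(T)\otimes\mathbb Q\cong\mathbb Q$, where $\chi(T)\cong\mathbb Z$ is the group of characters of $T$, $L(t)$ is the fractional linearization obtained by tensoring the canonical linearization $L$ with the fractional character $t$. For $\sigma\in\mathbb Q$, $\sigma$-semistable means semistable for $L(u-2\sigma)$, unstable means not semistable, and $Y_\sigma$ is the corresponding Mumford (GIT) quotient. The quotient $Y_{\frac12}$ is the projective bundle $\mathbb P\,\mathrm{Hom}(S_V,W)$ over $\mathrm{Gr}_uV$ (a nonzero map from a $u$-dimensional subspace of $V$ to $W$ corresponds to its graph). The quotients $Y_\sigma$ for $\sigma\in(0,u)$ are related by natural birational maps, coming from the open set of points semistable for both values of $\sigma$;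 the proper transform is taken with respect to these. $Z_k^-\subset Y_{k-\frac12}$ is the locus consisting of (images of) points unstable for all $\sigma>k$; the fibered product $Y_{k-\frac12}\times_{Y_k}Y_{k+\frac12}$ is the blow-up of $Y_{k-\frac12}$ along it. $\mathrm{Sec}_k(S_V,W)\subset\mathbb P\,\mathrm{Hom}(S_V,W)$ is the locus of linear maps of rank $\le k$, which is the variety of secant $(k-1)$-planes to the relative Segre embedding of $\mathbb P S_V^*\times\mathbb P W$. *)

(* Defs.v *)
From HB Require Import structures.
From mathcomp Require Import all_boot all_order all_algebra.
From mathcomp Require Import boolp classical_sets topology_structure.
From mathcomp Require Import mpoly.

Set Implicit Arguments.
Unset Strict Implicit.
Unset Printing Implicit Defensive.

Import GRing.Theory.

Local Open Scope classical_set_scope.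
Local Open Scope ring_scope.
Local Open Scope quotient_scope.

(* Varieties are represented by their closed points, over an algebraically    *)
(* closed field of characteristic 0; loci and (reduced) closed subvarieties   *)
(* are sets of closed points.                                                 *)

Section Grassmannian.
Variables (F : closedFieldType) (E : vectType F) (u : nat).

Definition Gr := {U : {vspace E} | \dim U == u}.

HB.instance Definition _ := Choice.on Gr.

Definition frame_eval (f : {mpoly F[u * \dim {:E}]}) (e : u.-tuple E) : F :=
  f.@[fun k => mxvec (\matrix_(i < u, j < \dim {:E})
                       coord (vbasis {:E}) j (tnth e i)) 0 k].

Definition frame_change (g : 'M[F]_u) (e : u.-tuple E) : u.-tuple E :=
  [tuple \sum_j g i j *: tnth e j | i < u].

(* Sections over Gr of the n-th power of the ample line bundle                *)
(* L = det S^* ~ det Q: such a section s is the same thing as the function    *)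
(* f(e) = s(<e>)(e_1 /\ ... /\ e_u) on frames e, subject to                   *)
(* f(g e) = (det g)^n f(e). The regular functions on frames are the           *)
(* polynomials on E^u, because non-frames have codimension                    *)
(* dim E - u + 1 >= 2 in E^u as soon as u < dim E, as is the case for         *)
(* E = V (+) W and 0 < u <= min (dim V) (dim W).                              *)
Definition is_section (n : nat) (f : {mpoly F[u * \dim {:E}]}) : Prop :=
  forall (g : 'M[F]_u) (e : u.-tuple E), g \in unitmx ->
    frame_eval f (frame_change g e) = \det g ^+ n * frame_eval f e.

Definition nonvanishing (f : {mpoly F[u * \dim {:E}]}) (U : Gr) : Prop :=
  exists2 e : u.-tuple E, basis_of (val U) e & frame_eval f e != 0.

End Grassmannian.

Section Quotient.
Variables (F : closedFieldType) (V W : vectType F) (u : nat).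

Local Notation E := (V * W)%type.
Local Notation Y := (Gr E u).

Definition torus_act (lambda : F) (x : E) : E :=
  (lambda *: x.1, lambda^-1 *: x.2).

(* T-invariant sections of L(t)^n. The character n t of T must be integral;   *)
(* then lambda in T maps the fibre of L(t)^n at U to the fibre at lambda U by *)
(* phi |-> lambda^(n t) phi o lambda^-1.                                      *)
(* The canonical linearization of L is the one given by the linear action of  *)
(* T on the Pluecker coordinates, that is, by L = det S^*. The isomorphism    *)
(* det Q = det S^* (x) det (V (+) W) is T-equivariant only up to the constant *)
(* character dim V - dim W of det (V (+) W), which is thus disregarded. This  *)
(* is the normalization for which the quotient at sigma = 1/2 is              *)
(* P Hom(S_V, W).                                                             *)
Definition invariant_section (t : rat) (n : nat)
    (f : {mpoly F[u * \dim {:E}]}) : Prop :=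
  is_section n f /\
  exists2 m : int, m%:~R = n%:R * t &
    forall (lambda : F) (e : u.-tuple E), lambda != 0 ->
      frame_eval f (map_tuple (torus_act lambda) e)
        = lambda ^ m * frame_eval f e.

(* The nonvanishing locus of a section of a positive power of L is affine     *)
(* because L is ample.                                                        *)
Definition semistable_for (t : rat) (U : Y) : Prop :=
  exists (n : nat) (f : {mpoly F[u * \dim {:E}]}),
    [/\ (0 < n)%N, invariant_section t n f & nonvanishing f U].

Definition weight (sigma : rat) : rat := u%:R - 2%:R * sigma.

Definition semistable (sigma : rat) (U : Y) : Prop :=
  semistable_for (weight sigma) U.

Definition unstable (sigma : rat) (U : Y) : Prop := ~ semistable sigma U.

Definition Yss (sigma : rat) : Type :=
  set_type [set U : Y | semistable sigma U].

HB.instance Definition _ sigma := Choice.on (Yss sigma).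

(* Y_sigma is Proj of the graded ring of T-invariant sections of the powers   *)
(* of L(u - 2 sigma). Its closed points are the images of the semistable      *)
(* points of Y, the image of x being the homogeneous ideal of the invariants  *)
(* vanishing at x; its basic open sets are the loci D_+(f).                   *)
Definition same_image (sigma : rat) (x y : Yss sigma) : Prop :=
  forall (n : nat) (f : {mpoly F[u * \dim {:E}]}),
    (0 < n)%N -> invariant_section (weight sigma) n f ->
    (nonvanishing f (val x) <-> nonvanishing f (val y)).

Definition same_imageb (sigma : rat) : rel (Yss sigma) :=
  fun x y => `[< same_image x y >].

Lemma same_image_equiv (sigma : rat) : equiv_class_of (@same_imageb sigma).
Proof.
split=> [x|x y|y x z].
- by apply/asboolP => n f n0 fi.
- by apply/asboolP/asboolP => xy n f n0 fi; have := xy n f n0 fi; tauto.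
- move=> /asboolP xy /asboolP yz; apply/asboolP => n f n0 fi.
  by have := xy n f n0 fi; have := yz n f n0 fi; tauto.
Qed.

Canonical same_image_equiv_rel (sigma : rat) :=
  EquivRelPack (same_image_equiv sigma).

Definition GITquotient (sigma : rat) : Type :=
  {eq_quot (same_image_equiv_rel sigma)}.

HB.instance Definition _ sigma := Choice.on (GITquotient sigma).
HB.instance Definition _ sigma := Quotient.on (GITquotient sigma).

Definition basic_open (sigma : rat) (f : {mpoly F[u * \dim {:E}]}) :
    set (GITquotient sigma) :=
  [set \pi_(GITquotient sigma) x | x in
    [set x : Yss sigma | nonvanishing f (val x)]].

HB.instance Definition _ sigma :=
  @isSubBaseTopological.Build (GITquotient sigma) (set (GITquotient sigma))
    [set D | exists (n : nat) (f : {mpoly F[u * \dim {:E}]}),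
      [/\ (0 < n)%N, invariant_section (weight sigma) n f
        & D = basic_open (sigma := sigma) f]]
    id.

(* Graph of the natural birational map between Y_sigma and Y_tau.             *)
Definition birational_corr (sigma tau : rat)
    (p : GITquotient sigma) (q : GITquotient tau) : Prop :=
  exists (x : Yss sigma) (y : Yss tau),
    [/\ val x = val y, p = \pi_(GITquotient sigma) x
      & q = \pi_(GITquotient tau) y].

Definition proper_transform (sigma tau : rat) (A : set (GITquotient sigma)) :
    set (GITquotient tau) :=
  closure [set q : GITquotient tau | exists2 p, A p & birational_corr p q].

Definition Zminus (k : nat) : set (GITquotient (k%:R - 2%:R^-1)) :=
  [set \pi_(GITquotient (k%:R - 2%:R^-1)) x | x in
    [set x : Yss (k%:R - 2%:R^-1) |
      forall sigma : rat, (k%:R < sigma)%R -> unstable sigma (val x)]].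

Definition graph (S : Gr V u) (phi : 'Hom(subvs_of (val S), W)) : {vspace E} :=
  limg (linfun (fun v : subvs_of (val S) => (vsval v, phi v) : E)).

(* Sec_k(S_V, W), transported to Y_{1/2} by the identification of the latter  *)
(* with P Hom(S_V, W): the class of a nonzero map corresponds to its graph.   *)
Definition Sec (k : nat) : set (GITquotient 2%:R^-1) :=
  [set p | exists (S : Gr V u) (phi : 'Hom(subvs_of (val S), W))
                  (x : Yss 2%:R^-1),
    [/\ phi != 0, (\dim (limg phi) <= k)%N, val (val x) = graph phi
      & p = \pi_(GITquotient 2%:R^-1) x]].

End Quotient.

Arguments GITquotient {F} V W u sigma.
Arguments basic_open {F V W u} sigma f.
Arguments proper_transform {F V W u sigma} tau A.
Arguments Zminus {F} V W u k.
Arguments Sec {F} V W u k.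

(* Main.v *)
From HB Require Import structures.
Require Import Defs.
From mathcomp Require Import all_boot all_order all_algebra.
From mathcomp Require Import boolp classical_sets topology_structure filter.
From mathcomp Require Import ring lra mpoly.

Set Implicit Arguments.
Unset Strict Implicit.
Unset Printing Implicit Defensive.

Import Order.TTheory GRing.Theory Num.Theory.

Local Open Scope ring_scope.

(** Write rankV U and rankW U for the dimensions of the projections to V and W
    of a u-dimensional subspace U of V (+) W, so that U meets W in dimension
    u - rankV U. The proof rests on the Hilbert-Mumford criterion in this
    explicit situation: U can be sigma-semistable only if
    u - rankV U <= sigma <= rankW U (semistable_bounds), and conversely
    u - rankV U < sigma <= rankW U suffices (semistable_intro).

    The bounds hold because a section of weight u - 2 sigma restricts, along
    the orbit of U, to a Laurent monomial in the parameter of T, whereas in a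
    basis of U adapted to the projections that restriction is a polynomial
    divisible by a known power of the parameter (section_degenerate).
    Invariant sections are built from Pluecker coordinates, the W-degree of such a
    coordinate being the number of W-factors of its multivector: one of W-degree
    u - rankV U and one of W-degree rankW U do not vanish at U. A
    monomial in them, with exponents such that the average W-degree is sigma,
    is invariant. When sigma > u - rankV U it involves the second coordinate,
    so it vanishes wherever rankW drops below rankW U (separating_section).

    Consequently the points of Y_(k-1/2) are the classes of the U with
    u - rankV U < k <= rankW U, the locus Z_k^- is given by rankW U = k
    (Zminus_rankW), and Sec_k is given in Y_(1/2) by rankW U <= k (SecE), since
    the semistable points there are the graphs, the graph of phi having rankW
    equal to the rank of phi. The image of Sec_k in Y_(k-1/2) is therefore the
    locus rankW U = k, rankV U = u. It remains to see that Z_k^- is its closure: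
    - Z_k^- is closed, because the separating section of a point with
      rankW U > k vanishes on all of it;
    - the image of Sec_k is dense in it: the invariant sections have basic opens
      that form a base (basic_open_base), and adding s (b_i, 0), with b_i
      independent vectors of V, to a basis of U makes rankV equal to u for
      almost all s without changing rankW (deform_off_W). *)

(** * Sections of powers of L as functions on frames *)

Section Frames.
Variables (F : closedFieldType) (E : vectType F) (u : nat).
Implicit Types (f : {mpoly F[u * \dim {:E}]}) (e : u.-tuple E).

Lemma frame_eval_line f (e0 e1 : u.-tuple E) :
  exists p : {poly F}, forall s : F,
    frame_eval f [tuple tnth e0 i + s *: tnth e1 i | i < u] = p.[s].
Proof.
pose c e k := mxvec (\matrix_(i < u, j < \dim {:E})
                       coord (vbasis {:E}) j (tnth e i)) 0 k.
exists (\sum_(m <- msupp f) (f@_m)%:P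
          * \prod_k ((c e0 k)%:P + (c e1 k)%:P * 'X) ^+ m k) => s.
rewrite /frame_eval mevalE horner_sum; apply: eq_bigr => m _.
rewrite hornerM hornerC horner_prod; congr (_ * _); apply: eq_bigr => k _.
rewrite horner_exp !hornerE; congr (_ ^+ _).
rewrite /c; case/mxvec_indexP: k => i j; rewrite !mxvecE !mxE tnth_mktuple.
by rewrite linearD linearZ /= mulrC.
Qed.

(** The section of L given by the volume form pulled back along T; the Pluecker
    coordinates are the case where T is a projection to coordinates. *)
Definition plucker (T : 'Hom(E, 'rV[F]_u)) : {mpoly F[u * \dim {:E}]} :=
  \det (\matrix_(i, j)
          \sum_(k < \dim {:E}) T (tnth (vbasis {:E}) k) 0 j *: 'X_(mxvec_index i k)).

Lemma frame_eval_plucker (T : 'Hom(E, 'rV[F]_u)) e :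
  frame_eval (plucker T) e = \det (\matrix_i T (tnth e i)).
Proof.
rewrite /frame_eval /plucker -det_map_mx; congr (\det _).
apply/matrixP => i j; rewrite !mxE raddf_sum /=.
rewrite [in RHS](coord_vbasis (memvf (tnth e i))) linear_sum summxE.
apply: eq_bigr => k _; rewrite mevalZ mevalXU mxvecE mxE linearZ mxE mulrC.
by rewrite -tnth_nth.
Qed.

Lemma plucker_section (T : 'Hom(E, 'rV[F]_u)) : is_section 1 (plucker T).
Proof.
move=> g e _; rewrite !frame_eval_plucker expr1 -det_mulmx; congr (\det _).
apply/row_matrixP => i; rewrite rowK tnth_mktuple row_mul mulmx_sum_row.
by rewrite linear_sum; apply: eq_bigr => j _; rewrite rowK linearZ mxE.
Qed.

Lemma plucker_neq0_free (T : 'Hom(E, 'rV[F]_u)) e :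
  frame_eval (plucker T) e != 0 -> free e.
Proof.
rewrite frame_eval_plucker => d0; apply/freeP => c ce i.
have: (\row_j c j) *m (\matrix_i T (tnth e i)) = 0.
  move/(congr1 T): ce; rewrite linear_sum linear0 mulmx_sum_row; apply: etrans.
  apply: eq_bigr => l _.
  by rewrite rowK mxE linearZ (tnth_nth 0).
have gu : \matrix_i T (tnth e i) \in unitmx by rewrite unitmxE unitfE.
by move/(canRL (mulmxK gu)); rewrite mul0mx => /rowP/(_ i); rewrite !mxE.
Qed.

(** Nonvanishing of the determinant is injectivity of T on the span of e; in this
    form no basis of U adapted to T has to be chosen. *)
Lemma plucker_neq0 (T : 'Hom(E, 'rV[F]_u)) (U : {vspace E}) e :
  basis_of U e -> (forall x, x \in U -> T x = 0 -> x = 0) ->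
  frame_eval (plucker T) e != 0.
Proof.
move=> eU injT; rewrite frame_eval_plucker -unitfE -unitmxE -row_free_unit.
rewrite -kermx_eq0; apply/eqP/row_matrixP => i; set c := row _ _.
have : c *m (\matrix_i T (tnth e i)) = 0 by rewrite -row_mul mulmx_ker linear0.
have ceU : \sum_j c 0 j *: tnth e j \in U.
  by apply: memv_suml => j _; rewrite memvZ // (basis_mem eU) // mem_tnth.
rewrite mulmx_sum_row => cT; have /injT : T (\sum_j c 0 j *: tnth e j) = 0.
  rewrite linear_sum; apply: etrans cT; apply: eq_bigr => j _.
  by rewrite rowK linearZ.
move=> /(_ ceU) ce0; rewrite row0; apply/rowP => j; rewrite [RHS]mxE.
apply: (freeP (basis_free eU) (c 0)); apply: etrans ce0; apply: eq_bigr => l _.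
by rewrite (tnth_nth 0).
Qed.

Lemma frame_changeM (g h : 'M[F]_u) e :
  frame_change (g *m h) e = frame_change g (frame_change h e).
Proof.
apply: eq_from_tnth => i; rewrite !tnth_mktuple.
under [RHS]eq_bigr do rewrite tnth_mktuple scaler_sumr.
rewrite exchange_big /=; apply: eq_bigr => j _; rewrite mxE scaler_suml.
by apply: eq_bigr => l _; rewrite scalerA.
Qed.

Lemma basis_frame_change (U : {vspace E}) e e' :
  basis_of U e -> basis_of U e' ->
  exists2 g, g \in unitmx & e' = frame_change g e.
Proof.
have transition e1 e2 : basis_of U e1 -> basis_of U e2 ->
    exists g, e2 = frame_change g e1.
  move=> e1U e2U; exists (\matrix_(i, j) coord e1 j (tnth e2 i)).
  apply: eq_from_tnth => i; rewrite tnth_mktuple.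
  rewrite {1}(coord_basis e1U (basis_mem e2U (mem_tnth i e2))).
  by apply: eq_bigr => j _; rewrite mxE -tnth_nth.
move=> eU e'U; have [g e'E] := transition _ _ eU e'U; exists g => //.
have [h eE] := transition _ _ e'U eU.
have : e = frame_change (h *m g) e by rewrite frame_changeM -e'E.
move=> hge; suff /mulmx1_unit[] : h *m g = 1%:M by [].
apply/matrixP => i j; apply/eqP; rewrite -subr_eq0; apply/eqP.
apply: (freeP (basis_free eU) (fun l => (h *m g) i l - (1%:M : 'M_u) i l)).
under eq_bigr do rewrite scalerBl -(tnth_nth 0).
move/(congr1 (fun t => tnth t i)): hge; rewrite tnth_mktuple => hge.
rewrite sumrB -hge (bigD1 i) //= !mxE eqxx scale1r.
rewrite big1 ?addr0 ?subrr // => l li.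
by rewrite mxE eq_sym (negPf li) scale0r.
Qed.

Lemma nonvanishingE n f (U : Gr E u) e : is_section n f ->
  basis_of (val U) e -> nonvanishing f U <-> frame_eval f e != 0.
Proof.
move=> fS eU; split=> [[e' e'U]|fe]; last by exists e.
have [g gu ->] := basis_frame_change eU e'U; rewrite fS //.
by rewrite mulf_eq0 negb_or => /andP[].
Qed.

End Frames.

(** * Degenerating a frame along a one-parameter subgroup *)

Section Degeneration.
Variables (F : closedFieldType) (E : vectType F) (u : nat).
Implicit Types (f : {mpoly F[u * \dim {:E}]}) (e : u.-tuple E).

Lemma poly_eq0_nonzero (p : {poly F}) :
  (forall s, s != 0 -> p.[s] = 0) -> p = 0.
Proof.
move=> p0; apply/eqP; apply: contraT => pN0.
have /closed_nonrootP[s] : p * 'X != 0 by rewrite mulf_neq0 ?polyX_eq0.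
rewrite rootE hornerM hornerX mulf_eq0 negb_or => /andP[ps s0].
by rewrite p0 ?eqxx in ps.
Qed.

Lemma section_scale n f e s : is_section n f -> s != 0 ->
  frame_eval f [tuple s *: tnth e i | i < u] = s ^+ (u * n) * frame_eval f e.
Proof.
move=> fS s0; have -> : s ^+ (u * n) = \det (s%:M : 'M_u) ^+ n.
  by rewrite det_scalar exprM.
rewrite -fS; last by rewrite unitmxE det_scalar unitfE expf_neq0.
congr (frame_eval f _); apply: eq_from_tnth => i; rewrite !tnth_mktuple.
rewrite (bigD1 i) //= mxE eqxx mulr1n big1 ?addr0 // => j ji.
by rewrite mxE eq_sym (negPf ji) mulr0n scale0r.
Qed.

(** The function s |-> f (e0 + s^2 e1) is a monomial of degree N. Each vector of
    the frame with e0_i = 0 lets s^2 be pulled out of the determinant, and what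
    remains is a polynomial in s^2; so if twice n times the number of such
    vectors exceeds N, then the constant f e agrees, for all s <> 0, with a
    positive power of s times a polynomial, and so is 0. *)
Lemma section_degenerate n f e (e0 e1 : u.-tuple E) (N : int) :
  is_section n f ->
  (forall s, s != 0 ->
     frame_eval f [tuple tnth e0 i + s ^+ 2 *: tnth e1 i | i < u]
       = s ^ N * frame_eval f e) ->
  (N < (2 * n * #|[pred i | tnth e0 i == 0%R]|)%:Z)%R ->
  frame_eval f e = 0.
Proof.
set J := [pred i | _] => fS fN; rewrite -subr_gt0.
case Ec: (_ - N) => [[|c]|c] // _.
(* The frame after division by s^2 of the vectors indexed by J. *)
pose e0' := [tuple if J i then tnth e1 i else tnth e0 i | i < u].
pose e1' := [tuple if J i then 0 else tnth e1 i | i < u].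
have [p pE] := frame_eval_line f e0' e1'.
have fe s : s != 0 -> frame_eval f e = s ^+ c.+1 * p.[s ^+ 2].
  move=> s0; pose g := diag_mx (\row_(i < u) if J i then s ^+ 2 else 1).
  have detg : \det g = s ^+ 2 ^+ #|J|.
    rewrite det_diag -prodr_const [RHS]big_mkcond /=.
    by apply: eq_bigr => i _; rewrite mxE.
  have : frame_eval f [tuple tnth e0 i + s ^+ 2 *: tnth e1 i | i < u]
         = \det g ^+ n * p.[s ^+ 2].
    rewrite -pE -fS; last by rewrite unitmxE unitfE detg !expf_neq0.
    congr (frame_eval f _); apply: eq_from_tnth => i; rewrite !tnth_mktuple.
    rewrite (bigD1 i) //= big1 ?addr0 => [|j ji]; last first.
      by rewrite mxE eq_sym (negPf ji) mulr0n scale0r.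
    rewrite !mxE eqxx mulr1n !tnth_mktuple; case: ifPn => [/eqP ->|_].
      by rewrite scaler0 addr0 add0r.
    by rewrite scale1r.
  rewrite fN // detg -!exprM => /(canRL (mulKf (expfz_neq0 N s0))) ->.
  rewrite mulrA; congr (_ * _).
  rewrite [RHS]exprnP -Ec expfzDr // invr_expz mulrC -exprnP; congr (_ ^+ _ * _).
  by rewrite mulnAC.
pose q := (frame_eval f e)%:P - 'X ^+ c.+1 * (p \Po ('X ^+ 2)).
have /(congr1 (horner^~ 0)) : q = 0.
  apply: poly_eq0_nonzero => s s0.
  by rewrite !hornerE horner_comp !hornerE -fe ?subrr.
by rewrite !hornerE expr0n mul0r subr0.
Qed.

(** Complete a basis of the kernel of g on U. *)
Lemma adapted_basis (E' : vectType F) (g : 'Hom(E, E')) (U : {vspace E}) :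
  \dim U = u -> exists2 e : u.-tuple E, basis_of U e
    & (u <= #|[pred i | g (tnth e i) == 0%R]| + \dim (g @: U))%N.
Proof.
move=> dU; pose X := vbasis (U :\: lker g) ++ vbasis (U :&: lker g).
have dUX : (U :\: lker g + U :&: lker g)%VS = U by rewrite addv_diff_cap.
have XU : basis_of U X.
  rewrite -[U in basis_of U]dUX cat_basis ?vbasisP //.
  apply/directv_addP; apply/eqP; rewrite -subv0 -(capv_diff U (lker g)).
  by rewrite capvS // capvSr.
have szX : size X == u by rewrite -dU -(span_basis XU) (eqnP (basis_free XU)).
have dK : (\dim (U :&: lker g) + \dim (g @: U))%N = u by rewrite limg_ker_dim.
exists (Tuple szX) => //; rewrite -[leqLHS]dK leq_add2r.
set t := Tuple szX.
have -> : #|[pred i | g (tnth t i) == 0]| = count (fun x => g x == 0) X.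
  by rewrite -[X]/(tval t) -sum1_count big_tuple sum1_card.
rewrite count_cat -[leqLHS]add0n leq_add // leq_eqVlt; apply/orP; left.
rewrite -{1}(size_tuple (vbasis (U :&: lker g))) eq_sym -all_count.
apply/allP => x /vbasis_mem; rewrite memv_cap => /andP[_].
by rewrite memv_ker.
Qed.

End Degeneration.

(** * Semistability in terms of the ranks of the two projections *)

Section Stability.
Variables (F : closedFieldType) (V W : vectType F) (u : nat).

Local Notation E := (V * W)%type.
Local Notation Y := (Gr E u).
Implicit Types (f : {mpoly F[u * \dim {:E}]}) (e : u.-tuple E) (U : Y).

Definition prV : 'Hom(E, V) := linfun fst.
Definition prW : 'Hom(E, W) := linfun snd.

Lemma prVE x : prV x = x.1. Proof. by rewrite lfunE. Qed.
Lemma prWE x : prW x = x.2. Proof. by rewrite lfunE. Qed.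

Definition rankV (U : {vspace E}) : nat := \dim (prV @: U).
Definition rankW (U : {vspace E}) : nat := \dim (prW @: U).

(** Up to the scalar s, which acts on sections by a known power, the element s^-1
    of T multiplies the W-components by s^2 and fixes the V-components; the
    element s does the opposite. Letting s tend to 0 in a basis containing as many
    vectors of W, respectively of V, as possible gives the two bounds. *)
Lemma semistable_bounds sigma U : semistable sigma U ->
  u%:R <= sigma + (rankV (val U))%:R /\ sigma <= (rankW (val U))%:R.
Proof.
move=> [n [f [n0 [fS [m mE fT]] fU]]].
have n0Q : 0 < n%:R :> rat by rewrite ltr0n.
have dU : \dim (val U) = u by apply/eqP/(valP U).
split; rewrite leNgt; apply/negP => lt_sigma.
  have [e eU Je] := adapted_basis prV dU.
  have /negP[] := (nonvanishingE fS eU).1 fU; apply/eqP.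
  pose e0 := [tuple ((tnth e i).1, 0) : E | i < u].
  pose e1 := [tuple (0, (tnth e i).2) : E | i < u].
  apply: (@section_degenerate _ _ _ _ _ e e0 e1 ((u * n)%:Z - m) fS) => [s s0|].
    rewrite expfzDr // -exprnP -exprz_inv -mulrA -fT ?invr_eq0 //.
    rewrite -(section_scale _ fS) //; congr (frame_eval f _).
    apply: eq_from_tnth => i; rewrite !tnth_mktuple tnth_map.
    congr pair => /=; first by rewrite scaler0 addr0 scalerA divff // scale1r.
    by rewrite add0r scalerA invrK.
  have -> : #|[pred i | tnth e0 i == 0]| = #|[pred i | prV (tnth e i) == 0]|.
    apply: eq_card => i; rewrite !inE tnth_mktuple prVE.
    by rewrite -pair_eqE /pair_eq /= eqxx andbT.
  set J := #|_| in Je *; rewrite -(ltr_int rat) rmorphB /= mE /weight.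
  have {}Je : u%:R <= J%:R + (rankV (val U))%:R :> rat by rewrite -natrD ler_nat.
  rewrite -!pmulrn !natrM; nra.
have [e eU Je] := adapted_basis prW dU.
have /negP[] := (nonvanishingE fS eU).1 fU; apply/eqP.
pose e0 := [tuple (0, (tnth e i).2) : E | i < u].
pose e1 := [tuple ((tnth e i).1, 0) : E | i < u].
apply: (@section_degenerate _ _ _ _ _ e e0 e1 ((u * n)%:Z + m) fS) => [s s0|].
  rewrite expfzDr // -exprnP -mulrA -fT //.
  rewrite -(section_scale _ fS) //; congr (frame_eval f _).
  apply: eq_from_tnth => i; rewrite !tnth_mktuple tnth_map.
  congr pair => /=; first by rewrite add0r scalerA.
  by rewrite scaler0 addr0 scalerA divff // scale1r.
have -> : #|[pred i | tnth e0 i == 0]| = #|[pred i | prW (tnth e i) == 0]|.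
  apply: eq_card => i; rewrite !inE tnth_mktuple prWE.
  by rewrite -pair_eqE /pair_eq /= eqxx.
set J := #|_| in Je *; rewrite -(ltr_int rat) rmorphD /= mE /weight.
have {}Je : u%:R <= J%:R + (rankW (val U))%:R :> rat by rewrite -natrD ler_nat.
rewrite -!pmulrn !natrM; nra.
Qed.

Lemma invariant_section_mul t1 t2 t n1 n2 f1 f2 :
  invariant_section t1 n1 f1 -> invariant_section t2 n2 f2 ->
  (n1 + n2)%:R * t = n1%:R * t1 + n2%:R * t2 ->
  invariant_section t (n1 + n2) (f1 * f2).
Proof.
move=> [f1S [m1 m1E f1T]] [f2S [m2 m2E f2T]] tE; split=> [g e gu|].
  by rewrite /frame_eval !rmorphM /= -!/(frame_eval _ _) f1S // f2S // exprD mulrACA.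
exists (m1 + m2) => [|s e s0]; first by rewrite rmorphD /= m1E m2E.
rewrite /frame_eval !rmorphM /= -!/(frame_eval _ _) f1T // f2T //.
by rewrite expfzDr // mulrACA.
Qed.

Lemma invariant_section_exp t n f i :
  invariant_section t n f -> invariant_section t (i * n) (f ^+ i).
Proof.
move=> fI; elim: i => [|i IH]; last first.
  rewrite mulSn exprS; apply: invariant_section_mul fI IH _.
  by rewrite natrD mulrDl.
split=> [g e _|]; first by rewrite mul0n !expr0 /frame_eval !rmorph1 mulr1.
exists 0 => [|s e _]; first by rewrite mul0n mul0r.
by rewrite expr0 /frame_eval !rmorph1 expr0z mulr1.
Qed.

(** A fixed but arbitrary extension to X of the k-th coordinate on A; it is 0 when
    k is out of range, so that k can be a plain natural number. *)
Definition vcoord (X : vectType F) (A : {vspace X}) (k : nat) (x : X) : F :=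
  if insub k is Some i then coord (vbasis A) i x else 0.

Lemma vcoord_linear (X : vectType F) (A : {vspace X}) k : scalar (vcoord A k).
Proof.
move=> a x y; rewrite /vcoord; case: insub => [i|]; first exact: linearP.
by rewrite mulr0 addr0.
Qed.

Lemma vcoord_eq0 (X : vectType F) (A : {vspace X}) x : x \in A ->
  (forall k, (k < \dim A)%N -> vcoord A k x = 0) -> x = 0.
Proof.
move=> xA x0; rewrite (coord_vbasis xA) big1 // => i _.
by have := x0 i (ltn_ord i); rewrite /vcoord valK => ->; rewrite scale0r.
Qed.

(** A map to F^u whose first \dim A entries depend on the V-component only and
    whose other entries depend on the W-component only: its determinant is an
    eigenvector of T of W-degree u - \dim A. *)
Definition split_coord (A : {vspace V}) (B : {vspace W}) (x : E) : 'rV[F]_u :=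
  \row_j if (j < \dim A)%N then vcoord A j x.1 else vcoord B (j - \dim A) x.2.

Lemma split_coord_linear A B : linear (split_coord A B).
Proof.
move=> a x y; apply/rowP => j; rewrite !mxE.
by case: ifP => _; rewrite vcoord_linear.
Qed.

HB.instance Definition _ A B :=
  GRing.isLinear.Build F E 'rV[F]_u _ (split_coord A B) (split_coord_linear A B).

Lemma split_coord_eq0 A B x : (\dim A + \dim B)%N = u -> split_coord A B x = 0 ->
  (x.1 \in A -> x.1 = 0) /\ (x.2 \in B -> x.2 = 0).
Proof.
move=> dAB x0; split=> /vcoord_eq0; apply => k lt_k.
  have ku : (k < u)%N by rewrite -dAB ltn_addr.
  by have /rowP/(_ (Ordinal ku)) := x0; rewrite !mxE /= lt_k.
have ku : (\dim A + k < u)%N by rewrite -dAB ltn_add2l.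
have /rowP/(_ (Ordinal ku)) := x0.
by rewrite !mxE /= ltnNge leq_addr /= addKn.
Qed.

Definition split_plucker A B := plucker (linfun (split_coord A B)).

Lemma split_plucker_invariant A B : (\dim A + \dim B)%N = u ->
  invariant_section (weight u (\dim B)%:R) 1 (split_plucker A B).
Proof.
move=> dAB; split; first exact: plucker_section.
exists ((\dim A)%:Z - (\dim B)%:Z) => [|s e s0].
  by rewrite rmorphB /= -!pmulrn /weight -dAB natrD; ring.
pose d := \row_(j < u) if (j < \dim A)%N then s else s^-1.
have -> : s ^ ((\dim A)%:Z - (\dim B)%:Z) = \det (diag_mx d).
  rewrite det_diag expfzDr // -exprz_inv -!exprnP.
  transitivity (\prod_(j < u) if (j < \dim A)%N then s else s^-1); last first.
    by apply: eq_bigr => j _; rewrite mxE.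
  rewrite -[in RHS]dAB big_split_ord /=; congr (_ * _).
    by under eq_bigr do rewrite ltn_ord; rewrite prodr_const card_ord.
  by under eq_bigr do rewrite ltnNge leq_addr /=; rewrite prodr_const card_ord.
rewrite !frame_eval_plucker mulrC -det_mulmx; congr (\det _).
apply/matrixP => i j; rewrite mul_mx_diag !mxE tnth_map !lfunE !mxE /= mulrC.
by case: ifP => _; rewrite /vcoord; case: insub => [l|]; rewrite ?linearZ ?mulr0.
Qed.

Lemma split_plucker_nonvanishing A B U : (\dim A + \dim B)%N = u ->
  (forall x, x \in val U -> (x.1 \in A -> x.1 = 0) -> (x.2 \in B -> x.2 = 0) ->
     x = 0) ->
  nonvanishing (split_plucker A B) U.
Proof.
move=> dAB injU; have dU : \dim (val U) == u := valP U.
have eU : basis_of (val U) (tcast (eqP dU) (vbasis (val U))).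
  by rewrite val_tcast vbasisP.
exists (tcast (eqP dU) (vbasis (val U))) => //.
apply: plucker_neq0 eU _ => x xU; rewrite lfunE /= => /(split_coord_eq0 dAB)[].
exact: injU.
Qed.

(** With A = U :&: V and B the projection of U to W, the coordinates of the
    W-component detect membership in V, and those of the V-component then detect
    0. *)
Lemma max_section U : exists f,
  invariant_section (weight u (rankW (val U))%:R) 1 f /\ nonvanishing f U.
Proof.
pose A := (prV @: (val U :&: lker prW))%VS; pose B := (prW @: val U)%VS.
have dAB : (\dim A + \dim B)%N = u.
  rewrite limg_dim_eq ?limg_ker_dim ?(eqP (valP U)) //.
  apply/eqP; rewrite -subv0; apply/subvP => x.
  rewrite !memv_cap !memv_ker prVE prWE memv0 => /andP[/andP[_ x2] x1].
  by rewrite -pair_eqE /pair_eq /= x1 x2.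
exists (split_plucker A B); split; first exact: split_plucker_invariant.
apply: split_plucker_nonvanishing => // x xU x1 x2.
have {}x2 : x.2 = 0 by apply: x2; rewrite -prWE memv_img.
suff x1E : x.1 = 0 by rewrite [x]surjective_pairing x1E x2.
by apply: x1; rewrite -prVE memv_img // memv_cap xU memv_ker prWE x2 /=.
Qed.

(** The same with the roles exchanged: A is the projection of U to V and
    B = U :&: W. *)
Lemma min_section U : exists f,
  invariant_section (weight u (u%:R - (rankV (val U))%:R)) 1 f /\
  nonvanishing f U.
Proof.
pose A := (prV @: val U)%VS; pose B := (prW @: (val U :&: lker prV))%VS.
have dAB : (\dim A + \dim B)%N = u.
  rewrite addnC limg_dim_eq ?limg_ker_dim ?(eqP (valP U)) //.
  apply/eqP; rewrite -subv0; apply/subvP => x.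
  rewrite !memv_cap !memv_ker prVE prWE memv0 => /andP[/andP[_ x1] x2].
  by rewrite -pair_eqE /pair_eq /= x1 x2.
exists (split_plucker A B); split.
  have -> : u%:R - (rankV (val U))%:R = (\dim B)%:R :> rat.
    by rewrite -[in u%:R]dAB natrD addrC addKr.
  exact: split_plucker_invariant.
apply: split_plucker_nonvanishing => // x xU x1 x2.
have {}x1 : x.1 = 0 by apply: x1; rewrite -prVE memv_img.
suff x2E : x.2 = 0 by rewrite [x]surjective_pairing x1 x2E.
by apply: x2; rewrite -prWE memv_img // memv_cap xU memv_ker prVE x1 /=.
Qed.

Lemma rat_nneg_frac (r : rat) : 0 <= r ->
  exists n d : nat, (0 < d)%N /\ r * d%:R = n%:R.
Proof.
move=> r0; exists `|numq r|%N, `|denq r|%N; rewrite absz_gt0 denq_neq0; split=> //.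
rewrite !pmulrn !gez0_abs ?numq_ge0 ?denq_ge0 //.
by rewrite -[r in r * _]divq_num_den divfK // intr_eq0 denq_neq0.
Qed.

(** A monomial f^i g^j in the two extremal sections of U, of W-degrees
    a = u - rankV U and b = rankW U, is invariant as soon as
    i (sigma - a) = j (b - sigma). The strict inequality gives j > 0, so the
    zeros of g are zeros of the product; and where g does not vanish, rankW is at
    least b by semistable_bounds applied at b. *)
Lemma separating_section sigma U :
  u%:R < sigma + (rankV (val U))%:R -> sigma <= (rankW (val U))%:R ->
  exists n f, [/\ (0 < n)%N, invariant_section (weight u sigma) n f,
    nonvanishing f U &
    forall U' : Y, nonvanishing f U' -> (rankW (val U) <= rankW (val U'))%N].
Proof.
move=> lt_a le_b; have [f [fI [e eU fe]]] := min_section U.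
have [g [gI gU]] := max_section U.
have ge := (nonvanishingE gI.1 eU).1 gU.
have [x [d [d0 xd]]] : exists n d : nat, (0 < d)%N /\
    ((rankW (val U))%:R - sigma) * d%:R = n%:R.
  by apply: rat_nneg_frac; rewrite subr_ge0.
have [y [c [c0 yc]]] : exists n d : nat, (0 < d)%N /\
    (sigma + (rankV (val U))%:R - u%:R) * d%:R = n%:R.
  by apply: rat_nneg_frac; rewrite subr_ge0 ltW.
have y0 : (0 < y)%N.
  by rewrite -(ltr0n rat) -yc mulr_gt0 ?ltr0n // subr_gt0.
exists (x * c * 1 + y * d * 1)%N, (f ^+ (x * c) * g ^+ (y * d)); split.
- by rewrite addn_gt0 !muln1 !muln_gt0 y0 d0 orbT.
- apply: invariant_section_mul (invariant_section_exp _ fI)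
    (invariant_section_exp _ gI) _.
  by rewrite !muln1 natrD !natrM -xd -yc /weight; ring.
- exists e => //; rewrite /frame_eval rmorphM !rmorphXn /= -!/(frame_eval _ _).
  by rewrite mulf_neq0 ?expf_neq0.
move=> U' [e' eU']; rewrite /frame_eval rmorphM !rmorphXn /= -!/(frame_eval _ _).
rewrite mulf_eq0 negb_or => /andP[_]; rewrite expf_eq0 muln_gt0 y0 d0 /= => ge'.
suff /semistable_bounds[_] : semistable (rankW (val U))%:R U' by rewrite ler_nat.
by exists 1%N, g; split=> //; exists e'.
Qed.

Lemma semistable_intro sigma U :
  u%:R < sigma + (rankV (val U))%:R -> sigma <= (rankW (val U))%:R ->
  semistable sigma U.
Proof. by move=> /separating_section/[apply] -[n [f [? ? ? _]]]; exists n, f. Qed.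

End Stability.

Arguments prV {F V W}.
Arguments prW {F V W}.

(** * Moving a subspace off W *)

Section Deformation.
Variables (F : closedFieldType) (V W : vectType F) (u : nat).

Local Notation E := (V * W)%type.
Local Notation Y := (Gr E u).

Lemma subspace_of_dim (X : vectType F) (m : nat) : (m <= \dim {:X})%N ->
  exists A : {vspace X}, \dim A = m.
Proof.
move=> le_m; exists <<take m (vbasis {:X})>>%VS.
have /eqnP -> : free (take m (vbasis {:X})).
  have := basis_free (vbasisP {:X}).
  by rewrite -{1}(cat_take_drop m (vbasis {:X})) => /catl_free.
by rewrite size_takel // size_tuple.
Qed.

(** Add s (b_i, 0) to a basis of U, with b_i independent in V. The W-components do
    not change. The determinant of the coordinates of the V-components on the b_i
    is a characteristic polynomial evaluated at s, so both it and f are nonzero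
    for some s; the former then bounds rankV from below through
    semistable_bounds at 0. *)
Lemma deform_off_W n f (U : Y) : (u <= \dim {:V})%N -> is_section n f ->
  nonvanishing f U ->
  exists U' : Y, [/\ nonvanishing f U', rankV (val U') = u
    & rankW (val U') = rankW (val U)].
Proof.
move=> /subspace_of_dim[A dA] fS [e eU fe].
have dAB : (\dim A + \dim (0%VS : {vspace W}))%N = u by rewrite dimv0 addn0.
pose e1 : u.-tuple E := [tuple ((vbasis A)`_i, 0) | i < u].
have [p pE] := frame_eval_line f e e1.
pose T : 'Hom(E, 'rV[F]_u) := linfun (split_coord u A 0).
have Te1 i : T (tnth e1 i) = delta_mx 0 i.
  apply/rowP => j; have lt_j : (j < \dim A)%N by rewrite dA.
  have lt_i : (i < \dim A)%N by rewrite dA.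
  rewrite lfunE tnth_mktuple !mxE /= lt_j /vcoord insubT.
  apply: etrans (coord_free (Ordinal lt_i) _ (basis_free (vbasisP A))) _.
  by rewrite eq_sym.
pose M := \matrix_i T (tnth e i).
have qE s : frame_eval (plucker T) [tuple tnth e i + s *: tnth e1 i | i < u]
            = (char_poly (- M)).[s].
  rewrite frame_eval_plucker -horner_evalE -det_map_mx; congr (\det _).
  apply/matrixP => i j; rewrite mxE tnth_mktuple linearD linearZ /= Te1 !mxE.
  rewrite horner_evalE hornerD hornerN hornerMn hornerX hornerC opprK eqxx /=.
  by rewrite addrC eq_sym; case: eqP; rewrite ?mulr1 ?mulr0.
have p0 : p != 0.
  apply: contraNneq fe => p0; have := pE 0; rewrite p0 horner0 => <-.
  apply/eqP; congr (frame_eval f _); apply: eq_from_tnth => i.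
  by rewrite tnth_mktuple scale0r addr0.
have /closed_nonrootP[s] : p * char_poly (- M) != 0.
  by rewrite mulf_neq0 // monic_neq0 // char_poly_monic.
rewrite rootE hornerM mulf_eq0 negb_or -pE -qE.
set es := [tuple _ | i < u] => /andP[fes Tes].
have es_free := plucker_neq0_free Tes.
have dU' : \dim <<es>> == u by rewrite (eqnP es_free) size_tuple.
pose U' : Y := Sub <<es>>%VS dU'.
have esU' : basis_of (val U') es by rewrite /basis_of es_free eqxx.
exists U'; split; first by exists es.
  apply/eqP; rewrite eqn_leq {1}/rankV -[X in (_ <= X)%N](eqP dU').
  rewrite -[X in (_ <= X)%N](limg_ker_dim prV) leq_addl /=.
  suff /semistable_bounds[] : semistable (\dim (0%VS : {vspace W}))%:R U'.
    by rewrite dimv0 add0r ler_nat.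
  exists 1%N, (split_plucker u A 0); split=> //; last by exists es.
  exact: split_plucker_invariant.
rewrite /rankW -(span_basis eU) /= !limg_span.
suff -> : map prW es = map_tuple prW e by [].
rewrite -[LHS]/(tval (map_tuple prW es)); congr tval.
apply: eq_from_tnth => i; rewrite !tnth_map !tnth_ord_tuple linearD linearZ /=.
by rewrite !prWE /= scaler0 addr0.
Qed.

End Deformation.

(** * Graphs of linear maps *)

Section Graphs.
Variables (F : closedFieldType) (V W : vectType F) (u : nat).

Local Notation E := (V * W)%type.
Local Notation Y := (Gr E u).

(** The function whose image is graph phi, named so that its linearity can be
    declared. *)
Definition graph_fun (S : Gr V u) (phi : 'Hom(subvs_of (val S), W))
  (v : subvs_of (val S)) : E := (vsval v, phi v).

Lemma graph_fun_linear S phi : linear (@graph_fun S phi).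
Proof. by move=> a x y; rewrite /graph_fun !linearP. Qed.

HB.instance Definition _ S phi :=
  GRing.isLinear.Build F (subvs_of (val S)) E _ (@graph_fun S phi)
    (@graph_fun_linear S phi).

Lemma mem_graph (S : Gr V u) (phi : 'Hom(subvs_of (val S), W)) x :
  reflect (exists v, x = (vsval v, phi v)) (x \in graph phi).
Proof.
rewrite -[graph phi]/(limg (linfun (@graph_fun S phi))).
apply: (iffP memv_imgP) => [[v _ ->]|[v ->]]; exists v; rewrite ?memvf ?lfunE //.
Qed.

Lemma rankW_graph (S : Gr V u) (phi : 'Hom(subvs_of (val S), W)) :
  (rankW (graph phi) <= \dim (limg phi))%N.
Proof.
apply/dimvS/subvP => _ /memv_imgP[x /mem_graph[v ->] ->].
by rewrite prWE memv_img ?memvf.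
Qed.

(** When rankV U = u the projection of U to V is injective; phi is its inverse
    followed by the projection to W. *)
Lemma graph_of_rankV (U : Y) : rankV (val U) = u ->
  exists (S : Gr V u) (phi : 'Hom(subvs_of (val S), W)),
    val U = graph phi /\ limg phi = (prW @: val U)%VS.
Proof.
move=> rU; pose S : Gr V u := Sub (prV @: val U)%VS (introT eqP rU).
pose lift := (projv (val U) \o (prV \o projv (val U))^-1)%VF.
have liftU v : lift v \in val U by rewrite comp_lfunE memv_proj.
have liftK v : v \in val S -> prV (lift v) = v.
  move=> /memv_imgP[x xU ->]; rewrite comp_lfunE.
  have /limg_lfunVK : prV x \in limg (prV \o projv (val U)).
    by rewrite limg_comp limg_proj memv_img.
  by rewrite comp_lfunE.
pose phi : 'Hom(subvs_of (val S), W) := (prW \o lift \o linfun vsval)%VF.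
have phiE v : phi v = prW (lift (vsval v)).
  rewrite comp_lfunE [(prW \o lift)%VF _]comp_lfunE; congr (prW (lift _)).
  exact: lfunE.
have UE : val U = graph phi.
  apply/esym/eqP; rewrite eqEdim; apply/andP; split.
    apply/subvP => _ /mem_graph[v ->].
    suff -> : (vsval v, phi v) = lift (vsval v) by [].
    by rewrite [RHS]surjective_pairing -prVE -prWE liftK ?subvsP ?phiE.
  rewrite (eqP (valP U)) -[leqLHS]rU -(limg_ker_dim prV (graph phi)).
  rewrite (leq_trans _ (leq_addl _ _)) // dimvS //; apply/subvP => v vS.
  have -> : v = prV (v, phi (vsproj (val S) v)) by rewrite prVE.
  apply/memv_img/mem_graph; exists (vsproj (val S) v); by rewrite vsprojK.
exists S, phi; split=> //; apply/eqP; rewrite eqEsubv.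
apply/andP; split; apply/subvP => w /memv_imgP[x].
  by move=> _ ->; rewrite phiE memv_img.
rewrite UE => /mem_graph[v ->] ->. by rewrite prWE memv_img ?memvf.
Qed.

End Graphs.

(** * The quotients and their topology *)

Section Quotients.
Variables (F : closedFieldType) (V W : vectType F) (u : nat).
Local Open Scope quotient_scope.
Local Open Scope classical_set_scope.

Local Notation E := (V * W)%type.
Local Notation Y := (Gr E u).

Lemma pi_eqP sigma (x y : Yss V W u sigma) :
  \pi_(GITquotient V W u sigma) x = \pi_(GITquotient V W u sigma) y <->
  same_image x y.
Proof.
split=> [/eqmodP/asboolP //|xy]; apply/eqmodP; exact/asboolP.
Qed.

Lemma basic_openP sigma n f (x : Yss V W u sigma) : (0 < n)%N ->
  invariant_section (weight u sigma) n f ->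
  basic_open sigma f (\pi_(GITquotient V W u sigma) x) <-> nonvanishing f (val x).
Proof.
move=> n0 fI; split=> [[y fy /pi_eqP yx]|fx]; last by exists x.
by apply/(yx n f n0 fI).
Qed.

Lemma open_basic_open sigma n f : (0 < n)%N ->
  invariant_section (weight u sigma) n f ->
  open (basic_open sigma f : set (GITquotient V W u sigma)).
Proof.
move=> n0 fI.
eexists [set basic_open sigma f]; last by rewrite bigcup_set1.
move=> _ ->; apply: finI_from1.
by exists n, f.
Qed.

(** A finite intersection of basic opens is the basic open of the product of the
    sections; for the empty intersection the section witnesses semistability. *)
Lemma basic_open_inter sigma (x : Yss V W u sigma)
    (s : seq (set (GITquotient V W u sigma))) :
  (forall D, D \in s -> D (\pi_(GITquotient V W u sigma) x) /\
    exists n f, [/\ (0 < n)%N, invariant_section (weight u sigma) n f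
                   & D = basic_open sigma f]) ->
  exists n f, [/\ (0 < n)%N, invariant_section (weight u sigma) n f,
    nonvanishing f (val x) & forall D, D \in s -> basic_open sigma f `<=` D].
Proof.
elim: s => [_|D s IH sP].
  by have [n [f [n0 fI fx]]] := set_valP x; exists n, f; split.
have [|n [f [n0 fI [e eU fx] fs]]] := IH.
  by move=> D' sD; apply: sP; rewrite inE sD orbT.
have [Dx [m [g [m0 gI DE]]]] := sP D (mem_head _ _).
have /(basic_openP x m0 gI) gx :
    basic_open sigma g (\pi_(GITquotient V W u sigma) x) by rewrite -DE.
have ge := (nonvanishingE gI.1 eU).1 gx.
exists (n + m)%N, (f * g); split.
- by rewrite addn_gt0 n0.
- by apply: invariant_section_mul fI gI _; rewrite natrD mulrDl.
- by exists e => //; rewrite /frame_eval rmorphM /= mulf_neq0.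
move=> D'; rewrite inE => /orP[/eqP -> | /fs fD'] q [y [e' e'U]].
  rewrite /frame_eval rmorphM mulf_eq0 negb_or => /andP[_ ge'] yq; rewrite -yq.
  by rewrite DE; exists y => //; exists e'.
rewrite /frame_eval rmorphM mulf_eq0 negb_or => /andP[fe' _] yq; rewrite -yq.
by apply: fD'; exists y => //; exists e'.
Qed.

(** The topology is given by a subbase, but products of invariant sections are
    invariant, so the subbase is a base. *)
Lemma basic_open_base sigma (x : Yss V W u sigma)
    (B : set (GITquotient V W u sigma)) :
  nbhs (\pi_(GITquotient V W u sigma) x) B ->
  exists n f, [/\ (0 < n)%N, invariant_section (weight u sigma) n f,
    nonvanishing f (val x) & basic_open sigma f `<=` B].
Proof.
rewrite nbhsE => -[_ [[D' sD' <-] [C D'C Cx]] sB].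
have [A sA CE] := sD' _ D'C.
have [D AD|n [f [n0 fI fx fA]]] := @basic_open_inter sigma x (finmap.enum_fset A).
  have {}Cx : C (\pi_(GITquotient V W u sigma) x) := Cx.
  split; first by move: Cx; rewrite -CE; apply.
  by have := sA _ AD; rewrite inE.
exists n, f; split=> // q fq; apply: sB; exists C; first exact: D'C.
have <- : \bigcap_(D in [set D | D \in finmap.enum_fset A]) D = C := CE.
by move=> D AD; apply: fA fq.
Qed.

(** At a half-integer both bounds are strict, so there they characterize
    semistability. *)
Lemma semistable_midE k sigma (U : Y) : sigma = k%:R - 2%:R^-1 ->
  semistable sigma U <-> (u < k + rankV (val U))%N /\ (k <= rankW (val U))%N.
Proof.
move=> ->; split=> [/semistable_bounds[le_V le_W]|[]].
  split; first by rewrite -(ltr_nat rat) natrD; lra.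
  by rewrite -ltnS -(ltr_nat rat) -natr1; lra.
rewrite -(ltr_nat rat) -(ler_nat rat) natrD => lt_V le_W.
have {}lt_V : u%:R + 1 <= k%:R + (rankV (val U))%:R :> rat.
  by move: lt_V; rewrite natr1 -!natrD ltr_nat ler_nat.
by apply: semistable_intro; lra.
Qed.

Lemma rankV_le (U : Y) : (rankV (val U) <= u)%N.
Proof. by rewrite -[leqRHS](eqP (valP U)) -(limg_ker_dim prV) leq_addl. Qed.

Lemma separating_section_mid k sigma (U : Y) :
  sigma = k%:R - 2%:R^-1 -> semistable sigma U ->
  exists n f, [/\ (0 < n)%N, invariant_section (weight u sigma) n f,
    nonvanishing f U &
    forall U' : Y, nonvanishing f U' -> (rankW (val U) <= rankW (val U'))%N].
Proof.
move=> sE; rewrite (semistable_midE U sE) sE => -[].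
rewrite -(ltr_nat rat) -(ler_nat rat) natrD => lt_V le_W.
have {}lt_V : u%:R + 1 <= k%:R + (rankV (val U))%:R :> rat.
  by move: lt_V; rewrite natr1 -!natrD ltr_nat ler_nat.
by apply: separating_section; lra.
Qed.

(** A class may have several representatives, and Sec only provides one that is a
    graph of a map of rank at most k. The separating section of x is an invariant
    that does not vanish at that representative either, whence the bound for
    x. *)
Lemma SecE k (x : Yss V W u 2%:R^-1) :
  Sec V W u k (\pi_(GITquotient V W u 2%:R^-1) x) <->
  (rankW (val (val x)) <= k)%N.
Proof.
have half : 2%:R^-1 = 1%:R - 2%:R^-1 :> rat by lra.
split=> [[S [phi [y [_ le_k yE /pi_eqP xy]]]]|le_k].
  have [n [f [n0 fI fx fr]]] := separating_section_mid half (set_valP x).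
  apply: leq_trans (fr _ ((xy n f n0 fI).1 fx)) _.
  by rewrite yE (leq_trans (rankW_graph _)).
have [lt_V W_gt0] := (semistable_midE (val x) half).1 (set_valP x).
have [|S [phi [xE phiE]]] := @graph_of_rankV _ _ _ _ (val x).
  by apply/eqP; rewrite eqn_leq rankV_le -ltnS.
exists S, phi, x; split=> //; last by rewrite phiE.
by apply: contraTneq W_gt0 => phi0; rewrite /rankW -phiE phi0 lim0g dimv0.
Qed.

(** If rankW U > k then U is still semistable at sigma = rankW U. *)
Lemma Zminus_rankW k (x : Yss V W u (k%:R - 2%:R^-1)) :
  (forall sigma : rat, k%:R < sigma -> unstable sigma (val x)) <->
  rankW (val (val x)) = k.
Proof.
have [lt_V ge_k] := (semistable_midE (val x) erefl).1 (set_valP x).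
split=> [unst|rk sigma lt_k /semistable_bounds[_]]; last first.
  by rewrite rk leNgt lt_k.
apply/eqP; rewrite eqn_leq ge_k andbT leqNgt; apply/negP => lt_k.
apply: (unst (rankW (val (val x)))%:R); first by rewrite ltr_nat.
apply: semistable_intro => //; rewrite -natrD ltr_nat.
by rewrite (leq_trans lt_V) // leq_add2r.
Qed.

End Quotients.

(** * The blow-up locus as a proper transform *)

Section ProperTransform.
Variables (F : closedFieldType) (V W : vectType F) (u k : nat).
Local Open Scope quotient_scope.
Local Open Scope classical_set_scope.

Let sigma : rat := k%:R - 2%:R^-1.

(** The density of the image of Sec_k in Z_k^-. *)
Lemma Zminus_sub_proper_transform : (u <= \dim {:V})%N -> (0 < k)%N ->
  Zminus V W u k `<=` proper_transform sigma (Sec V W u k).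
Proof.
move=> le_u k0 _ [x /Zminus_rankW xk <-] B /basic_open_base[n [f [n0 fI fx fB]]].
have [U [fU rV rW]] := deform_off_W le_u fI.1 fx.
have Us : semistable sigma U by exists n, f.
have Uh : semistable 2%:R^-1 U.
  by apply/(@semistable_midE _ _ _ _ 1); [lra|rewrite rV rW xk add1n].
pose y : Yss V W u sigma := SigSub (mem_set Us).
pose z : Yss V W u 2%:R^-1 := SigSub (mem_set Uh).
exists (\pi_(GITquotient V W u sigma) y); split; last first.
  by apply/fB/(basic_openP y n0 fI).
exists (\pi_(GITquotient V W u 2%:R^-1) z); last by exists z, y.
by apply/SecE; rewrite /= rW xk.
Qed.

(** The closedness of Z_k^-: the basic open set of a section separating x from the
    points of smaller rankW would otherwise miss the image of Sec_k. *)
Lemma proper_transform_sub_Zminus :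
  proper_transform sigma (Sec V W u k) `<=` Zminus V W u k.
Proof.
move=> q; rewrite -[q]reprK; set x := repr q => clx.
have [_ ge_k] := (semistable_midE (val x) erefl).1 (set_valP x).
exists x => //; apply/Zminus_rankW/eqP; rewrite eqn_leq ge_k andbT.
have [n [f [n0 fI fx fr]]] := separating_section_mid erefl (set_valP x).
have /clx[r [[p Ap [z [y [zy pE rE]]]] fr_r]] :
    nbhs (\pi_(GITquotient V W u sigma) x) (basic_open sigma f).
  apply: open_nbhs_nbhs; split; first exact: open_basic_open n0 fI.
  exact/(basic_openP x n0 fI).
apply: leq_trans (fr (val y) _) _; first by apply/(basic_openP y n0 fI); rewrite -rE.
by rewrite -zy; apply/SecE; rewrite -pE.
Qed.

End ProperTransform.

Theorem mainTheorem5 (F : closedFieldType) (charF0 : [pchar F]%R =i pred0)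
    (V W : vectType F) (u : nat) (u_gt0 : (0 < u)%N)
    (u_le : (u <= minn (\dim {:V}%VS) (\dim {:W}%VS))%N)
    (k : nat) (k_gt0 : (1 <= k)%N) (k_le : (k <= u - 1)%N) :
  Zminus V W u k = proper_transform (k%:R - 2%:R^-1)%R (Sec V W u k).
Proof.
apply/seteqP; split; last exact: proper_transform_sub_Zminus.
by apply: Zminus_sub_proper_transform => //; move: u_le; rewrite leq_min => /andP[].
Qed.
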